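(* Let $\mathfrak{A}$ and $\mathfrak{A}'$ be two alternative $W^*$-factors, let $n\ge2$ be an integer, and let $\varphi:\mathfrak{A}\to\mathfrak{A}'$ be a map preserving complex scalar multiplication, i.e. $\varphi(\lambda a)=\lambda\varphi(a)$ for all $\lambda\in\mathbb{C}$, $a\in\mathfrak{A}$. Then $\varphi$ is a bijective unital multiplicative $*$-Lie $n$-map if and only if $\varphi$ is a $*$-isomorphism.
   Context: All algebras are over the field of complex numbers $\mathbb{C}$ and are not assumed associative or commutative. An algebra $\mathfrak{A}$ is alternative if $a^2b = a(ab)$ and $ba^2 = (ba)a$ for all $a,b\in\mathfrak{A}$. A $*$-algebra is an algebra endowed with an involution, i.e. a map $*:\mathfrak{A}\to\mathfrak{A}$ with $(x+y)^*=x^*+y^*$, $(\lambda x)^*=\bar\lambda x^*$, $(x^* )^*=x$ and $(xy)^*=y^*x^*$ for all $x,y\in\mathfrak{A}$, $\lambda\in\mathbb{C}$. An alternative algebra $\mathfrak{A}$ is prime if whenever $a,b\in\mathfrak{A}$ satisfy $a\mathfrak{A}b=0$ (i.e. $(ax)b=0$ for all $x\in\mathfrak{A}$), then $a=0$ or $b=0$. An alternative $C^*$-algebra is a complete normed alternative complex $*$-algebra $A$ with $\|a^*a\|=\|a\|^2$ for all $a\in A$. An alternative $W^*$-algebra is an alternative $C^*$-algebra that is a dual Banach space. An alternative $W^*$-factor is a prime alternative $W^*$-algebra. Non-zero alternative $W^*$-algebras are unital; $1_{\mathfrak{A}}$ and $1_{\mathfrak{A}'}$ denote the identities. In a $*$-algebra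 put $[x_1,x_2]_*=x_1x_2-x_2x_1^*$, and define recursively $p_{1_*}(x)=x$ and $p_{n_*}(x_1,\ldots,x_n)=[p_{(n-1)_*}(x_1,\ldots,x_{n-1}),x_n]_*$ for $n\ge 2$. A map $\varphi:\mathfrak{A}\to\mathfrak{A}'$ (not assumed additive) is a multiplicative $*$-Lie $n$-map if $\varphi(p_{n_*}(x_1,\ldots,x_n))=p_{n_*}(\varphi(x_1),\ldots,\varphi(x_n))$ for all $x_1,\ldots,x_n\in\mathfrak{A}$. It is unital if $\varphi(1_{\mathfrak{A}})=1_{\mathfrak{A}'}$. It is a $*$-isomorphism if it is bijective, additive, and preserves products ($\varphi(ab)=\varphi(a)\varphi(b)$), scalar multiplication, and involution ($\varphi(a^* )=\varphi(a)^*$). *)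

(* Defs.v *)
(* The complex field is R[i] for an arbitrary R : realType. *)
From HB Require Import structures.
From mathcomp Require Import all_boot all_order all_algebra.
From mathcomp Require Import complex.
From mathcomp Require Import all_classical all_reals all_analysis.

Set Implicit Arguments.
Unset Strict Implicit.
Unset Printing Implicit Defensive.

Import Order.TTheory GRing.Theory Num.Theory.
Import numFieldNormedType.Exports.

Local Open Scope classical_set_scope.
Local Open Scope ring_scope.

(* The product amul is neither associative nor commutative, so the carrier
   cannot be an algType; it is a Banach space with a separate product. *)
Record altCstarAlgebra (R : realType) := AltCstarAlgebra {
  alg_carrier :> completeNormedModType R[i];
  amul : alg_carrier -> alg_carrier -> alg_carrier;
  astar : alg_carrier -> alg_carrier;
  amulDl : forall a b c, amul (a + b) c = amul a c + amul b c;
  amulDr : forall a b c, amul a (b + c) = amul a b + amul a c;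
  amulZl : forall (l : R[i]) a b, amul (l *: a) b = l *: amul a b;
  amulZr : forall (l : R[i]) a b, amul a (l *: b) = l *: amul a b;
  amul_altl : forall a b, amul (amul a a) b = amul a (amul a b);
  amul_altr : forall a b, amul b (amul a a) = amul (amul b a) a;
  astarD : forall a b, astar (a + b) = astar a + astar b;
  astarZ : forall (l : R[i]) a, astar (l *: a) = Num.conj l *: astar a;
  astarK : forall a, astar (astar a) = a;
  astarM : forall a b, astar (amul a b) = amul (astar b) (astar a);
  norm_amul_le : forall a b, `|amul a b| <= `|a| * `|b|;
  norm_Cstar : forall a, `|amul (astar a) a| = `|a| ^+ 2
}.

Section BanachDual.
Variable R : realType.

(* The norm of a normedModType over R[i] has its values in R[i], whence Re. *)
Definition functional_norm (X : normedModType R[i]) (f : X -> R[i]^o) : R :=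
  sup [set complex.Re `|f x| | x in [set x : X | `|x| <= 1]].

(* T is an isometric linear isomorphism of A onto the space of continuous
   linear functionals on X. *)
Definition isometric_to_dual (A X : normedModType R[i])
    (T : A -> X -> R[i]^o) : Prop :=
  [/\ forall a, linear (T a) /\ continuous (T a),
      forall (l : R[i]) a b x, T (l *: a + b) x = l *: T a x + T b x,
      forall a, `|a| = ((functional_norm (T a))%:C)%C
    & forall f : X -> R[i]^o, linear f -> continuous f -> exists a, T a = f].

Definition dual_banach_space (A : completeNormedModType R[i]) : Prop :=
  exists (X : completeNormedModType R[i]) (T : A -> X -> R[i]^o),
    isometric_to_dual T.

End BanachDual.

Section Algebra.
Variables (R : realType) (A : altCstarAlgebra R).

Definition prime_algebra : Prop :=
  forall a b : A, (forall x : A, amul (amul a x) b = 0) -> a = 0 \/ b = 0.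

Definition alt_Wstar_algebra : Prop := dual_banach_space A.

Definition alt_Wstar_factor : Prop := alt_Wstar_algebra /\ prime_algebra.

Definition is_identity (e : A) : Prop :=
  forall x : A, amul e x = x /\ amul x e = x.

Definition star_comm (x y : A) : A := amul x y - amul y (astar x).

(* foldl nests to the left: p (x1, ..., xn) = [p (x1, ..., x(n-1)), xn]_*.
   The value on the empty tuple is irrelevant. *)
Definition pstar (n : nat) (x : n.-tuple A) : A :=
  if tval x is a :: s then foldl star_comm a s else 0.

End Algebra.

Section Maps.
Variables (R : realType) (A A' : altCstarAlgebra R).

Definition star_Lie_map (n : nat) (phi : A -> A') : Prop :=
  forall x : n.-tuple A, phi (pstar x) = pstar (map_tuple phi x).

Definition star_isomorphism (phi : A -> A') : Prop :=
  [/\ bijective phi,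
      forall a b, phi (a + b) = phi a + phi b,
      forall a b, phi (amul a b) = amul (phi a) (phi b),
      forall (l : R[i]) a, phi (l *: a) = l *: phi a
    & forall a, phi (astar a) = astar (phi a)].

End Maps.

(* Main.v *)
(* No projections are needed. Restricted to self-adjoint elements and written
   with the Jordan product [x o y = xy + yx] and the commutator, the hypothesis
   says that phi (i[h,y] + k o y) = i[phi h, phi y] + phi k o phi y. Replacing y
   by y + r with r large leaves [h,y] unchanged and makes k o y = b solvable for
   every b, so phi (i[h,y] + b) = phi (i[h,y]) + phi b. Hence the additivity
   defect c = phi (a + b) - phi a - phi b commutes with the whole range, and so
   does every c z, because c o phi y is again such a defect. In a prime
   alternative algebra this forces c = 0 unless the algebra is commutative; then
   it has no zero divisors, (|h| - h)(|h| + h) = 0 gives every self-adjoint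
   element h - t a sign, and self-adjoint elements are real scalars, on which
   homogeneity already gives additivity. *)
Require Import Defs.
From mathcomp Require Import all_boot all_order all_algebra.
From mathcomp Require Import complex.
From mathcomp Require Import all_classical all_reals all_analysis.
From mathcomp Require Import ring lra.
Import Order.TTheory GRing.Theory Num.Theory.
Import numFieldNormedType.Exports.
Local Open Scope ring_scope.

Set Implicit Arguments.
Unset Strict Implicit.
Unset Printing Implicit Defensive.

(** * Real-valued norms and fixed points in Banach spaces *)

Section RealNorm.
Variables (R : realType) (V : normedModType R[i]).

(** The norm has values in [R[i]]; its real part carries the same information and is within reach of
    [lra] and [nra]. *)
Definition rnorm (x : V) : R := complex.Re `|x|.

Lemma rnormE x : `|x| = ((rnorm x)%:C)%C.
Proof. by rewrite /rnorm RRe_real // normr_real. Qed.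

Lemma rnorm_ge0 x : 0 <= rnorm x.
Proof. by rewrite -ler0c -rnormE. Qed.

Lemma rnorm0 : rnorm 0 = 0.
Proof. by rewrite /rnorm normr0. Qed.

Lemma rnormN x : rnorm (- x) = rnorm x.
Proof. by rewrite /rnorm normrN. Qed.

Lemma rnormB x y : rnorm (x - y) = rnorm (y - x).
Proof. by rewrite /rnorm distrC. Qed.

Lemma ler_rnormD x y : rnorm (x + y) <= rnorm x + rnorm y.
Proof. by rewrite -lecR rmorphD /= -!rnormE ler_normD. Qed.

Lemma rnorm_eq0 x : rnorm x <= 0 -> x = 0.
Proof.
move=> x0; apply: normr0_eq0; rewrite rnormE.
by rewrite (_ : rnorm x = 0) //; apply/le_anti; rewrite x0 rnorm_ge0.
Qed.

Lemma rnormZ l x : rnorm (l *: x) = complex.Re `|l| * rnorm x.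
Proof.
apply: (@complexI R); rewrite rmorphM -!rnormE normrZ /=.
by rewrite RRe_real ?normr_real.
Qed.

Lemma rnormZr (r : R) x : rnorm (r%:C%C *: x) = `|r| * rnorm x.
Proof. by rewrite rnormZ normc_def /= expr0n addr0 sqrtr_sqr. Qed.

Lemma rnormZi x : rnorm ('i%C *: x) = rnorm x.
Proof. by rewrite rnormZ normc_def /= expr0n add0r expr1n sqrtr1 mul1r. Qed.

End RealNorm.

Lemma rnorm_cauchy_cvg (R : realType) (V : completeNormedModType R[i])
    (x : nat -> V) :
  (forall eps, 0 < eps -> exists N, forall n, (N <= n)%N ->
     rnorm (x n - x N) < eps) ->
  exists l, forall eps, 0 < eps -> exists N, forall n, (N <= n)%N ->
     rnorm (l - x n) < eps.
Proof.
move=> xC.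
have : cauchy (x @ \oo)%classic.
  apply: cauchy_exP => _ /posnumP[eps].
  have : 0 < complex.Re (eps%:num).
    by have : 0 < eps%:num by []; rewrite ltcE => /andP[].
  move=> /xC[N HN]; exists (x N).
  exists N => // n /= /HN.
  rewrite -ball_normE /= -ltcR -rnormE RRe_real ?gtr0_real // distrC; exact.
move=> /cauchy_cvg /cvg_ex[l xl]; exists l => eps eps0.
have := xl; move/(cvgr_dist_lt) => /(_ (eps%:C)%C).
rewrite ltcR => /(_ eps0) [N _ HN]; exists N => n /HN /=.
by rewrite rnormE ltcR.
Qed.

(* Kantorovich's majorant principle: the iterates of F from 0 are dominated by
   those of f. Unlike a contraction argument it reaches the boundary case
   [rnorm a = 1] of x = (a + x^2)/2. *)
Lemma majorant_fixpoint (R : realType) (V : completeNormedModType R[i])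
    (F : V -> V) (f : R -> R) (M L : R) : 0 <= M -> 0 <= L ->
  (forall t, 0 <= t <= M -> f t <= M) ->
  rnorm (F 0) <= f 0 ->
  (forall x y s t, 0 <= t -> t <= s <= M -> rnorm x <= s -> rnorm y <= t ->
     rnorm (x - y) <= s - t -> rnorm (F x - F y) <= f s - f t) ->
  (forall x y, rnorm x <= M -> rnorm y <= M ->
     rnorm (F x - F y) <= L * rnorm (x - y)) ->
  exists x, [/\ F x = x, rnorm x <= M &
    forall eps, 0 < eps -> exists n, rnorm (x - iter n F 0) < eps].
Proof.
move=> M0 L0 fM F0 Ff FL.
pose t n := iter n f 0; pose x n := iter n F 0.
(* Domination is inductive: [t] increases below [M], and each increment of [x] is at most that of
   [t]. *)
have inv n : [/\ 0 <= t n, t n <= t n.+1 <= M, rnorm (x n) <= t n &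
    rnorm (x n.+1 - x n) <= t n.+1 - t n].
  elim: n => [|n [t0 /andP[tt tM] xt xx]].
    have f00 : 0 <= f 0 by apply: le_trans F0; exact: rnorm_ge0.
    by rewrite /= rnorm0 !subr0 f00 lexx fM ?lexx.
  have t1 : 0 <= t n.+1 by apply: le_trans tt.
  have xt1 : rnorm (x n.+1) <= t n.+1.
    have := ler_rnormD (x n.+1 - x n) (x n); rewrite subrK; lra.
  have Ftt : rnorm (x n.+2 - x n.+1) <= t n.+2 - t n.+1.
    by apply: Ff => //; rewrite tt.
  split=> //; rewrite fM ?t1 // andbT.
  by rewrite -subr_ge0 (le_trans _ Ftt) ?rnorm_ge0.
have xk n k : rnorm (x (n + k)%N - x n) <= t (n + k)%N - t n.
  elim: k => [|k IH]; first by rewrite addn0 !subrr rnorm0.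
  have [_ _ _ xx] := inv (n + k)%N.
  have := ler_rnormD (x (n + k).+1 - x (n + k)%N) (x (n + k)%N - x n).
  rewrite addnS addrA subrK; lra.
pose T := sup (range t).
have hT : has_sup (range t).
  split; first by exists (t 0%N), 0%N.
  by exists M => _ [n _ <-]; have [_ /andP[tt tM] _ _] := inv n; lra.
have tT n : t n <= T by apply: sup_upper_bound => //; exists n.
have [|l xl] := @rnorm_cauchy_cvg R V x.
  move=> eps eps0; have [_ [N _ <-] tN] := sup_adherent eps0 hT.
  exists N => n /subnKC <-; apply: le_lt_trans (xk _ _) _.
  by have := tT (N + (n - N))%N; rewrite -/T in tN; lra.
have lM : rnorm l <= M.
  apply/ler_addgt0Pr => eps /xl[N /(_ N (leqnn N)) lN].
  have := ler_rnormD (l - x N) (x N); rewrite subrK.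
  by have [_ /andP[tt tM] xt _] := inv N; lra.
exists l; split=> //; last by move=> eps /xl[N HN]; exists N; exact: HN.
apply/eqP; rewrite -subr_eq0; apply/eqP/rnorm_eq0/ler_addgt0Pr => eps eps0.
(* [F l] is compared with [l] through [x N.+1 = F (x N)]: the error at [x N] is multiplied by [L],
   the error at [x N.+1] by 1. *)
have eps1 : 0 < eps / (L + 1) by rewrite divr_gt0 //; lra.
have [N HN] := xl _ eps1.
have := HN N (leqnn N); have := HN N.+1 (leqnSn N).
have [_ /andP[tt tM] xt _] := inv N.
have := FL _ _ lM (le_trans xt (le_trans tt tM)).
have := ler_rnormD (F l - F (x N)) (x N.+1 - l).
rewrite addrA subrK (rnormB (x N.+1)) => h1 h2 h3 h4.
rewrite add0r; apply: le_trans h1 _.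
have -> : eps = L * (eps / (L + 1)) + eps / (L + 1).
  by field; rewrite gt_eqF //; lra.
apply: lerD; last exact: ltW.
by apply: le_trans h2 _; rewrite ler_wpM2l // ltW.
Qed.

Local Notation "x ** y" := (amul x y) (at level 40, left associativity).


(** * Cancellation of opposite terms in sums *)

Lemma cancel_pos (V : zmodType) (x t r : V) : t = - x + r -> r = 0 -> x + t = 0.
Proof. by move=> -> ->; rewrite addr0 subrr. Qed.

Lemma cancel_neg (V : zmodType) (x t r : V) : t = x + r -> r = 0 -> - x + t = 0.
Proof. by move=> -> ->; rewrite addr0 addNr. Qed.

(* Scaled terms are compared up to the instances hidden in [*:]. *)
Ltac same_term x y :=
  first
  [ constr_eq x y
  | lazymatch x with @GRing.scale _ _ ?l ?u =>
      lazymatch y with @GRing.scale _ _ ?m ?v => constr_eq l m; constr_eq u v end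
    end ].

Ltac find_neg x :=
  lazymatch goal with
  | |- ?a + _ = _ => first
    [ lazymatch a with - ?y => same_term x y end; reflexivity
    | refine (etrans (congr1 (+%R a) _) (addrCA a (- x) _)); find_neg x ]
  end.

Ltac find_pos x :=
  lazymatch goal with
  | |- ?a + _ = _ => first
    [ same_term x a; reflexivity
    | refine (etrans (congr1 (+%R a) _) (addrCA a x _)); find_pos x ]
  end.

(** All terms go to one side; each head is then cancelled against its opposite, which [find_neg] or
    [find_pos] carries to the front of the tail. The final 0 gives every summand the shape
    [_ + _]. *)
Ltac abel :=
  apply/eqP; rewrite -subr_eq0; apply/eqP;
  rewrite ?(opprD, opprK, oppr0, addr0, add0r) -[LHS]addr0 -?addrA;
  repeat lazymatch goal with
  | |- 0 = 0 => reflexivity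
  | |- - ?x + _ = 0 => refine (cancel_neg _ _); [find_pos x|]
  | |- ?x + _ = 0 => refine (cancel_pos _ _); [find_neg x|]
  end.

(** * Bilinearity, involution and norm *)

Section Algebra.
Variables (R : realType) (A : altCstarAlgebra R).
Implicit Types (a b c h k x y z : A) (l : R[i]).

Lemma amul0l x : 0 ** x = 0.
Proof. by rewrite -(scale0r 0) amulZl !scale0r. Qed.

Lemma amul0r x : x ** 0 = 0.
Proof. by rewrite -(scale0r 0) amulZr !scale0r. Qed.

Lemma amulNl x y : - x ** y = - (x ** y).
Proof. by rewrite -scaleN1r amulZl scaleN1r. Qed.

Lemma amulNr x y : x ** - y = - (x ** y).
Proof. by rewrite -scaleN1r amulZr scaleN1r. Qed.

Lemma amulBl x y z : (x - y) ** z = x ** z - y ** z.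
Proof. by rewrite amulDl amulNl. Qed.

Lemma amulBr x y z : x ** (y - z) = x ** y - x ** z.
Proof. by rewrite amulDr amulNr. Qed.

Definition amulE := (amulDl, amulDr, amulNl, amulNr, amulZl, amulZr).

Lemma astar0 : astar 0 = 0 :> A.
Proof. by rewrite -(scale0r 0) astarZ conjC0 !scale0r. Qed.

Lemma astarN x : astar (- x) = - astar x.
Proof. by rewrite -scaleN1r astarZ rmorphN1 scaleN1r. Qed.

Lemma astarB x y : astar (x - y) = astar x - astar y.
Proof. by rewrite astarD astarN. Qed.

Lemma conjCi : Num.conj ('i%C : R[i]) = - 'i%C.
Proof.
by apply/eqP; rewrite [Num.conj _]/(conjc _) eq_complex /= oppr0 !eqxx.
Qed.

Lemma conjCr (r : R) : Num.conj (r%:C%C : R[i]) = r%:C%C.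
Proof. exact: conjc_real. Qed.

Lemma i_neq0 : 'i%C != 0 :> R[i].
Proof. by rewrite eq_complex /= oner_eq0 andbF. Qed.

Lemma mulii : 'i%C * 'i%C = -1 :> R[i].
Proof. by rewrite -expr2 sqr_i. Qed.

Lemma astarZi x : astar ('i%C *: x) = - ('i%C *: astar x).
Proof. by rewrite astarZ conjCi scaleNr. Qed.

Lemma astarZr (r : R) x : astar (r%:C%C *: x) = r%:C%C *: astar x.
Proof. by rewrite astarZ conjCr. Qed.

(* [scalerA] does not rewrite here: the two [*:] can carry different, only
   convertible, ring instances. *)
Lemma scaleA l m x : l *: (m *: x) = (l * m) *: x.
Proof. exact: scalerA. Qed.

Lemma scaleii x : 'i%C *: ('i%C *: x) = - x.
Proof. by rewrite scalerA mulii scaleN1r. Qed.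

Lemma rnorm_amul x y : rnorm (x ** y) <= rnorm x * rnorm y.
Proof. by rewrite -lecR rmorphM /= -!rnormE norm_amul_le. Qed.

Lemma rnorm_Cstar x : rnorm (astar x ** x) = rnorm x ^+ 2.
Proof. by apply: (@complexI R); rewrite rmorphXn /= -!rnormE norm_Cstar. Qed.

(** The C*-identity bounds the square of [rnorm y] by [rnorm (astar y) * rnorm y]; cancel, then
    exchange [y] and [astar y]. *)
Lemma rnorm_astar x : rnorm (astar x) = rnorm x.
Proof.
suff le y : rnorm y <= rnorm (astar y).
  by apply/le_anti; rewrite le -{2}[x]astarK le.
have := rnorm_amul (astar y) y; rewrite rnorm_Cstar expr2.
have := rnorm_ge0 y; rewrite le_eqVlt => /predU1P[<- _|y0].
  exact: rnorm_ge0.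
by rewrite ler_pM2r.
Qed.

Lemma rnorm_sqrB x y s t : 0 <= t -> rnorm x <= s -> rnorm y <= t ->
  rnorm (x ** x - y ** y) <= rnorm (x - y) * (s + t).
Proof.
move=> t0 xs yt.
have -> : x ** x - y ** y = x ** (x - y) + (x - y) ** y by rewrite !amulE; abel.
apply: le_trans (ler_rnormD _ _) _.
have := rnorm_amul x (x - y); have := rnorm_amul (x - y) y.
have := rnorm_ge0 (x - y); nra.
Qed.

(** * Associators and commutators in an alternative algebra *)

Definition jordan x y : A := x ** y + y ** x.
Definition lie x y : A := x ** y - y ** x.
Definition assoc x y z : A := (x ** y) ** z - x ** (y ** z).

Lemma assoc_altl x y : assoc x x y = 0.
Proof. by rewrite /assoc amul_altl subrr. Qed.

Lemma assoc_altr x y : assoc x y y = 0.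
Proof. by rewrite /assoc amul_altr subrr. Qed.

(** Polarisation of [assoc_altl] at [x + y]. *)
Lemma assoc_swapl x y z : assoc x y z = - assoc y x z.
Proof.
apply/eqP; rewrite -addr_eq0 -(assoc_altl (x + y) z); apply/eqP.
transitivity (assoc x x z + assoc y y z + (assoc x y z + assoc y x z)).
  by rewrite !assoc_altl !add0r.
by rewrite /assoc !amulE; abel.
Qed.

Lemma assoc_swapr x y z : assoc x y z = - assoc x z y.
Proof.
apply/eqP; rewrite -addr_eq0 -(assoc_altr x (y + z)); apply/eqP.
transitivity (assoc x y y + assoc x z z + (assoc x y z + assoc x z y)).
  by rewrite !assoc_altr !add0r.
by rewrite /assoc !amulE; abel.
Qed.

(** The associator is alternating, so the three associators measuring the failure of the Leibniz
    rule agree up to sign. This is what makes commuting elements associate with all others. *)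
Lemma lie_leibniz x y z :
  lie (x ** y) z - x ** lie y z - lie x z ** y = assoc x y z *+ 3.
Proof.
have zxy : assoc z x y = assoc x y z.
  by rewrite (assoc_swapr x) (assoc_swapl x) opprK.
transitivity (assoc x y z + assoc z x y - assoc x z y); last first.
  by rewrite zxy -(assoc_swapr x y z) !mulrS mulr0n addr0 addrA.
by rewrite /lie /assoc !amulE; abel.
Qed.

(** * Commuting elements and primeness *)

Definition commuting c := forall x, lie c x = 0.

Lemma commutingP c x : commuting c -> c ** x = x ** c.
Proof. by move=> /(_ x)/eqP; rewrite subr_eq0 => /eqP. Qed.

Lemma lie_commuting c x : commuting c -> lie x c = 0.
Proof. by move=> /(_ x)/eqP; rewrite subr_eq0 /lie => /eqP ->; rewrite subrr. Qed.

Lemma mulr3n_eq0 x : x *+ 3 = 0 -> x = 0.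
Proof.
by rewrite -scaler_nat => /eqP; rewrite scaler_eq0 pnatr_eq0 => /orP[//|/eqP].
Qed.

(** With [z = c] in [lie_leibniz] all commutators vanish, leaving three times the associator. *)
Lemma commuting_assocr c x y : commuting c -> assoc x y c = 0.
Proof.
move=> cC; apply: mulr3n_eq0.
by rewrite -lie_leibniz !lie_commuting // amul0r amul0l !subrr.
Qed.

Lemma commuting_assocl c x y : commuting c -> assoc c x y = 0.
Proof.
by move=> cC; rewrite assoc_swapl assoc_swapr commuting_assocr // !oppr0.
Qed.

Lemma commuting_amulA c x y : commuting c -> (c ** x) ** y = c ** (x ** y).
Proof.
by move=> cC; apply/eqP; rewrite -subr_eq0 -/(assoc c x y) commuting_assocl.
Qed.

Lemma commuting_amulCA c x y : commuting c -> x ** (c ** y) = c ** (x ** y).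
Proof.
move=> cC; rewrite -(commuting_amulA x y cC) (commutingP x cC).
apply/esym/eqP; rewrite -subr_eq0 -/(assoc x c y).
by rewrite assoc_swapl commuting_assocl // oppr0.
Qed.

(** Since [c] commutes and associates with everything, [c ** lie x y = lie (c ** x) y = 0], so
    [(c ** z) ** lie x y = 0] for all [z], and primeness applies. *)
Lemma commuting_ideal_prime c : prime_algebra A -> c != 0 -> commuting c ->
  (forall x, commuting (c ** x)) -> forall x y, x ** y = y ** x.
Proof.
move=> pA c0 cC cxC x y.
suff [c00|] : c = 0 \/ lie x y = 0.
- by rewrite c00 eqxx in c0.
- by move/eqP; rewrite subr_eq0 => /eqP.
apply: pA => z; rewrite commuting_amulA // -(commuting_amulCA _ _ cC).
have := cxC x y.
rewrite /lie amulBr commuting_amulA // (commuting_amulCA _ _ cC) => ->.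
exact: amul0r.
Qed.

Lemma commutative_amulA : (forall x y, x ** y = y ** x) ->
  forall x y z, (x ** y) ** z = x ** (y ** z).
Proof.
by move=> mulC x y z; apply: commuting_amulA => u; rewrite /lie mulC subrr.
Qed.

Lemma commutative_prime_domain x y : (forall x y, x ** y = y ** x) ->
  prime_algebra A -> x ** y = 0 -> x = 0 \/ y = 0.
Proof.
move=> mulC pA xy0; apply: pA => z.
by rewrite commutative_amulA // (mulC z) -commutative_amulA // xy0 amul0l.
Qed.

(** * Self-adjoint elements and the identity *)

Lemma astar_jordan x y : astar (jordan x y) = jordan (astar x) (astar y).
Proof. by rewrite /jordan astarD !astarM addrC. Qed.

Lemma astar_lie x y : astar (lie x y) = - lie (astar x) (astar y).
Proof. by rewrite /lie astarB !astarM opprB. Qed.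

Definition self_adjoint x := astar x = x.

Lemma self_adjointD x y :
  self_adjoint x -> self_adjoint y -> self_adjoint (x + y).
Proof. by rewrite /self_adjoint astarD => -> ->. Qed.

Lemma self_adjointN x : self_adjoint x -> self_adjoint (- x).
Proof. by rewrite /self_adjoint astarN => ->. Qed.

Lemma self_adjointZr (r : R) x : self_adjoint x -> self_adjoint (r%:C%C *: x).
Proof. by rewrite /self_adjoint astarZr => ->. Qed.

Lemma self_adjoint_jordan x y :
  self_adjoint x -> self_adjoint y -> self_adjoint (jordan x y).
Proof. by rewrite /self_adjoint astar_jordan => -> ->. Qed.

Lemma self_adjoint_lie x y :
  self_adjoint x -> self_adjoint y -> self_adjoint ('i%C *: lie x y).
Proof.
by rewrite /self_adjoint astarZi astar_lie => -> ->; rewrite scalerN opprK.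
Qed.

Lemma self_adjoint_sqr x : self_adjoint x -> self_adjoint (x ** x).
Proof. by rewrite /self_adjoint astarM => ->. Qed.

Lemma scale_half_double x : (2^-1 : R)%:C%C *: (x *+ 2) = x.
Proof.
have -> : x *+ 2 = (2 : R)%:C%C *: x by rewrite rmorph_nat scaler_nat.
by rewrite scaleA -rmorphM /= mulVf ?pnatr_eq0 // scale1r.
Qed.

Lemma cartesian_decomposition x :
  exists h k, [/\ self_adjoint h, self_adjoint k & x = h + 'i%C *: k].
Proof.
exists ((2^-1 : R)%:C%C *: (x + astar x)).
exists ((2^-1 : R)%:C%C *: - ('i%C *: (x - astar x))).
split.
- by apply: self_adjointZr; rewrite /self_adjoint astarD astarK addrC.
- apply: self_adjointZr; rewrite /self_adjoint astarN astarZi astarB astarK.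
  by rewrite opprK -scalerN opprB.
rewrite scaleA mulrC -scaleA scalerN scaleii opprK -scalerDr.
by rewrite addrACA subrr addr0 -mulr2n scale_half_double.
Qed.

Lemma cartesian_sqr h k : self_adjoint h -> self_adjoint k ->
  astar (h + 'i%C *: k) ** (h + 'i%C *: k) = h ** h + k ** k + 'i%C *: lie h k.
Proof.
move=> sh sk; rewrite astarD astarZi sh sk /lie !amulE scaleii scalerDr scalerN.
by abel.
Qed.

Variable one : A.
Hypothesis one_id : is_identity one.

Lemma amul1l x : one ** x = x. Proof. by have [] := one_id x. Qed.
Lemma amul1r x : x ** one = x. Proof. by have [] := one_id x. Qed.

Lemma identity_unique e : is_identity e -> e = one.
Proof. by move=> eid; have [<- _] := eid one; rewrite amul1r. Qed.

Lemma self_adjoint1 : self_adjoint one.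
Proof.
apply: identity_unique => x.
by split; rewrite -[x in LHS]astarK -astarM ?amul1l ?amul1r astarK.
Qed.

(** The norm of [one] equals its own square; the value 0 occurs in the zero algebra. *)
Lemma rnorm1_le1 : rnorm one <= 1.
Proof.
have := rnorm_Cstar one; rewrite self_adjoint1 amul1l => e.
have := rnorm_ge0 one; nra.
Qed.

End Algebra.

(** * Jordan equations and square roots by iteration *)

Section Analysis.
Variables (R : realType) (A : altCstarAlgebra R) (one : A).
Hypothesis one_id : is_identity one.
Implicit Types (a b c h k x y z : A).

Let amul1l x : one ** x = x := amul1l one_id x.
Let amul1r x : x ** one = x := amul1r one_id x.
Let self_adjoint1 : self_adjoint one := self_adjoint1 one_id.

Lemma scale_double (r : R) x : r%:C%C *: (x *+ 2) = (r * 2)%:C%C *: x.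
Proof. by rewrite -scaler_nat scaleA rmorphM /= rmorph_nat. Qed.

Lemma scale_halves x : (2^-1 : R)%:C%C *: x + (2^-1 : R)%:C%C *: x = x.
Proof. by rewrite -scalerDr -mulr2n scale_half_double. Qed.

Lemma rnorm_jordan x y : rnorm (jordan x y) <= 2 * rnorm x * rnorm y.
Proof.
apply: le_trans (ler_rnormD _ _) _.
have := rnorm_amul x y; have := rnorm_amul y x; lra.
Qed.

(** The equation reads [2 r k + jordan k y = b], so [k] is a fixed point of [F], a contraction for
    large [r]. *)
Lemma lyapunov y b : self_adjoint y -> self_adjoint b ->
  exists (r : R) k,
    self_adjoint k /\ jordan k (y + r%:C%C *: one) = b.
Proof.
(* [rnorm y <= r / 2] makes [F] contract by 1/2; the added 1 keeps [r] positive. *)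
move=> sy sb; pose r := 2 * rnorm y + 1; have y0 := rnorm_ge0 y.
have r0 : 0 < r by rewrite /r; lra.
pose q := (r * 2)^-1; have q0 : 0 < q by rewrite invr_gt0 mulr_gt0.
pose F x := q%:C%C *: (b - jordan x y).
have FB x x' : rnorm (F x - F x') <= 2^-1 * rnorm (x - x').
  have -> : F x - F x' = q%:C%C *: (jordan (x' - x) y).
    by rewrite /F -scalerBr; congr (_ *: _); rewrite /jordan !amulE; abel.
  rewrite rnormZr gtr0_norm // (rnormB x).
  apply: (@le_trans _ _ (q * (2 * rnorm (x' - x) * (r / 2)))).
    rewrite ler_pM2l //; apply: le_trans (rnorm_jordan _ _) _.
    by rewrite ler_wpM2l ?mulr_ge0 ?rnorm_ge0 // /r; lra.
  have -> // : q * (2 * rnorm (x' - x) * (r / 2)) = 2^-1 * rnorm (x' - x).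
  by rewrite /q; field; rewrite gt_eqF.
pose M := 2 * rnorm (F 0); have F0 := rnorm_ge0 (F 0).
have [||||||x [Fx _ _]] := @majorant_fixpoint R A F
    (fun t => rnorm (F 0) + 2^-1 * t) M 2^-1 => //.
- by rewrite mulr_ge0.
- by move=> t; rewrite /M; lra.
- by lra.
- by move=> x x' s t _ _ _ _ xs; apply: le_trans (FB _ _) _; lra.
pose Y := y + r%:C%C *: one.
have sY : self_adjoint Y by apply: self_adjointD => //; exact: self_adjointZr.
have xY : jordan x Y = b.
  have -> : jordan x Y = jordan x y + r%:C%C *: (x *+ 2).
    by rewrite /jordan /Y !amulE amul1l amul1r mulr2n scalerDr; abel.
  rewrite scale_double -[in X in _ + X]Fx /F scaleA -rmorphM /= mulfV.
    by rewrite scale1r addrC subrK.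
  by rewrite gt_eqF // mulr_gt0.
(* Averaging [x] with its adjoint keeps the equation, since [y + r] and [b] are self-adjoint. *)
exists r, ((2^-1 : R)%:C%C *: x + (2^-1 : R)%:C%C *: astar x); split.
  by rewrite /self_adjoint astarD !astarZr astarK addrC.
rewrite -/Y; clearbody Y.
transitivity ((2^-1 : R)%:C%C *: jordan x Y +
              (2^-1 : R)%:C%C *: jordan (astar x) Y).
  by rewrite /jordan !amulDl !amulDr !amulZl !amulZr !scalerDr; abel.
by rewrite -[in jordan (astar x) Y]sY -astar_jordan xY sb scale_halves.
Qed.

(** Take [p = one - x] with [x = (a + x^2) / 2]. The bound on [one - p] later stands for
    nonnegativity of [p]. *)
Lemma sqrt_one_minus a : self_adjoint a -> rnorm a <= 1 ->
  exists p, [/\ self_adjoint p, rnorm (one - p) <= 1 & p ** p = one - a].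
Proof.
move=> sa a1; pose F x := (2^-1 : R)%:C%C *: (a + x ** x).
have FB x y s t : 0 <= t -> rnorm x <= s -> rnorm y <= t ->
    rnorm (F x - F y) <= 2^-1 * (rnorm (x - y) * (s + t)).
  move=> t0 xs yt.
  have -> : F x - F y = (2^-1 : R)%:C%C *: (x ** x - y ** y).
    by rewrite /F -scalerBr; congr (_ *: _); abel.
  rewrite rnormZr gtr0_norm ?invr_gt0 // ler_wpM2l ?invr_ge0 //.
  exact: rnorm_sqrB.
(* The majorant [(1 + t^2) / 2] touches the diagonal at 1, with slope 1 there; [F] is 1-Lipschitz on
   the unit ball. *)
have [||||||x [Fx x1 xF]] := @majorant_fixpoint R A F
    (fun t => 2^-1 * (1 + t * t)) 1 1 => //.
- by move=> t /andP[t0 t1]; nra.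
- rewrite /F amul0l addr0 rnormZr gtr0_norm ?invr_gt0 //; lra.
- move=> x y s t t0 /andP[ts s1] xs yt xy.
  apply: le_trans (FB _ _ _ _ t0 xs yt) _.
  have -> : 2^-1 * (1 + s * s) - 2^-1 * (1 + t * t) = 2^-1 * ((s - t) * (s + t)).
    by field.
  by rewrite ler_wpM2l ?invr_ge0 // ler_wpM2r //; lra.
- move=> x y x1 y1; apply: le_trans (FB _ _ 1 1 _ x1 y1) _ => //; lra.
have sF n : self_adjoint (iter n F 0).
  elim: n => [|n IH] /=; first exact: astar0.
  by apply/self_adjointZr/self_adjointD => //; exact: self_adjoint_sqr.
have sx : self_adjoint x.
  apply/eqP; rewrite -subr_eq0; apply/eqP/rnorm_eq0/ler_addgt0Pr => eps eps0.
  have [n xn] := xF (eps / 2) (divr_gt0 eps0 (ltr0Sn _ 1)).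
  have := ler_rnormD (astar (x - iter n F 0)) (iter n F 0 - x).
  rewrite rnorm_astar astarB sF addrA subrK (rnormB (iter n F 0)); lra.
exists (one - x); split.
- by apply: self_adjointD => //; exact: self_adjointN.
- by rewrite opprB addrC subrK.
have : x + x = a + x ** x.
  by rewrite -{1 2}Fx /F -scalerDr -mulr2n scale_half_double.
move=> xx; rewrite amulBl !amulBr !amul1l amul1r.
have -> : a = x + x - x ** x by rewrite xx addrK.
abel.
Qed.

End Analysis.

(** * The commutative prime case: self-adjoint elements are real scalars *)

Section Commutative.
Variables (R : realType) (A : altCstarAlgebra R) (one : A).
Hypothesis one_id : is_identity one.
Hypothesis A_prime : prime_algebra A.
Hypothesis amulC : forall x y : A, x ** y = y ** x.
Implicit Types (h k x y z : A).

Let amul1l x : one ** x = x := amul1l one_id x.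
Let amul1r x : x ** one = x := amul1r one_id x.
Let self_adjoint1 : self_adjoint one := self_adjoint1 one_id.
Let one1 : rnorm one <= 1 := rnorm1_le1 one_id.

Lemma cartesian_sqrC h k : self_adjoint h -> self_adjoint k ->
  rnorm (h + 'i%C *: k) ^+ 2 = rnorm (h ** h + k ** k).
Proof.
move=> sh sk; rewrite -rnorm_Cstar cartesian_sqr //.
by rewrite /lie amulC subrr scaler0 addr0.
Qed.

Lemma rnorm_imaginary_part h k : self_adjoint h -> self_adjoint k ->
  rnorm k <= rnorm (h + 'i%C *: k).
Proof.
move=> sh sk; set u := h + _.
have e : 'i%C *: (k *+ 2) = u - astar u.
  by rewrite /u astarD astarZi sh sk mulr2n scalerDr; abel.
have := ler_rnormD u (- astar u).
rewrite -e rnormZi rnormN rnorm_astar.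
have -> : rnorm (k *+ 2) = 2 * rnorm k.
  rewrite -[in RHS](scale_half_double k) rnormZr gtr0_norm ?invr_gt0 //; by field.
clear e; lra.
Qed.

(** If [k^2 = one - h^2], then [u = h + i k] has [u^* u = one], so [u], its imaginary part [k] and
    finally [k^2] have norm at most 1. *)
Lemma rnorm_one_minus_sqr h : self_adjoint h -> rnorm h <= 1 ->
  rnorm (one - h ** h) <= 1.
Proof.
move=> sh h1.
have hh1 : rnorm (h ** h) <= 1.
  by apply: le_trans (rnorm_amul _ _) _; have := rnorm_ge0 h; nra.
have [k [sk _ kk]] := sqrt_one_minus one_id (self_adjoint_sqr sh) hh1.
have u1 : rnorm (h + 'i%C *: k) <= 1.
  have := cartesian_sqrC sh sk; rewrite kk [_ + (one - _)]addrC subrK.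
  by have := one1; have := rnorm_ge0 (h + 'i%C *: k); nra.
have k1 := le_trans (rnorm_imaginary_part sh sk) u1.
rewrite -kk; apply: le_trans (rnorm_amul _ _) _; have := rnorm_ge0 k; nra.
Qed.

(* With p = |h|, the absence of zero divisors turns (p - h)(p + h) = 0 into
   h = p or h = - p. *)
Lemma self_adjoint_sign h : self_adjoint h -> rnorm h <= 1 ->
  rnorm (one - h) <= 1 \/ rnorm (one + h) <= 1.
Proof.
move=> sh h1.
have sa : self_adjoint (one - h ** h).
  by apply: self_adjointD => //; apply/self_adjointN/self_adjoint_sqr.
have [p [_ p1 pp]] := sqrt_one_minus one_id sa (rnorm_one_minus_sqr sh h1).
have ph0 : (p - h) ** (p + h) = 0.
  by rewrite !amulE pp (amulC h p); abel.
have [/eqP|/eqP] := commutative_prime_domain amulC A_prime ph0.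
  by rewrite subr_eq0 => /eqP <-; left.
by rewrite addr_eq0 => /eqP pN; right; rewrite -[h]opprK -pN.
Qed.

(** The bounds provide square roots [p] of [h] and [q] of [- h]; then [p^2 + q^2 = 0] forces
    [p + i q = 0], so [q = 0]. *)
Lemma self_adjoint_both_signs h : self_adjoint h ->
  rnorm (one - h) <= 1 -> rnorm (one + h) <= 1 -> h = 0.
Proof.
move=> sh h1 h2.
have [|p [sp _ pp]] := sqrt_one_minus one_id _ h1.
  by apply: self_adjointD => //; exact: self_adjointN.
have [|q [sq _ qq]] := sqrt_one_minus one_id _ h2.
  exact: self_adjointD.
have := cartesian_sqrC sp sq.
have -> : p ** p + q ** q = 0 by rewrite pp qq; abel.
rewrite rnorm0 => u0.
have u1 : rnorm (p + 'i%C *: q) <= 0.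
  by have := rnorm_ge0 (p + 'i%C *: q); nra.
have /rnorm_eq0 q0 : rnorm q <= 0.
  exact: le_trans (rnorm_imaginary_part sp sq) u1.
move/eqP: qq; rewrite q0 amul0l opprD addrA subrr add0r eq_sym oppr_eq0.
by move/eqP.
Qed.

(** A Dedekind cut: [t0] is the supremum of the [t <= 1/2] with [h - t] nonnegative, in the sense
    [rnorm (one - (h - s t)) <= 1], and [h - t0] has both signs. The bound 1/2 on [h] keeps [h - t]
    in the unit ball for [t] in [[-1/2, 1/2]], where [self_adjoint_sign] applies. *)
Lemma self_adjoint_scalar_small h : self_adjoint h -> rnorm h <= 2^-1 ->
  exists t : R, h = t%:C%C *: one.
Proof.
move=> sh h1.
pose s (r : R) : A := r%:C%C *: one.
have ss r : rnorm (s r) <= `|r|.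
  by rewrite rnormZr -[leRHS]mulr1 ler_wpM2l.
have sD r t : s (r + t) = s r + s t by rewrite /s rmorphD scalerDl.
have sN r : s (- r) = - s r by rewrite /s rmorphN scaleNr.
have s1 : s 1 = one by rewrite /s rmorph1 scale1r.
have sht t : self_adjoint (h - s t).
  by apply: self_adjointD => //; apply/self_adjointN/self_adjointZr.
pose S := [set t : R | t <= 2^-1 /\ rnorm (one - (h - s t)) <= 1]%classic.
have S0 : S (- 2^-1).
  split; first lra.
  have -> : one - (h - s (- 2^-1)) = s (1 - 2^-1) - h by rewrite sD s1; abel.
  apply: le_trans (ler_rnormD _ _) _; rewrite rnormN.
  by have := ss (1 - 2^-1); rewrite ger0_norm; lra.
have hS : has_sup S by split; [exists (- 2^-1) | exists (2^-1) => t []].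
pose t0 := sup S.
have t0h : t0 <= 2^-1 by apply: sup_le_ub => [|t []//]; exists (- 2^-1).
have t0l : - 2^-1 <= t0 by apply: sup_upper_bound.
exists t0; apply/eqP; rewrite -/(s t0) -subr_eq0; apply/eqP.
apply: (self_adjoint_both_signs (sht t0)).
(* Nonnegativity passes to [t0] from nearby members of [S]. *)
- apply/ler_addgt0Pr => eps eps0.
  have [t [t2 t1] tt0] := sup_adherent eps0 hS.
  have tle : t <= t0 by apply: sup_upper_bound.
  have := ler_rnormD (one - (h - s t)) (s (t0 - t)).
  have -> : one - (h - s t) + s (t0 - t) = one - (h - s t0).
    by rewrite sD sN; abel.
  by have := ss (t0 - t); rewrite ger0_norm -/t0 in tt0 *; lra.
- apply/ler_addgt0Pr => eps eps0.
  (* Just above [t0] the other sign must hold, since [t] is outside [S]; at the cap 1/2 it follows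
     from the bound on [h]. *)
  pose t := Num.min (t0 + eps) 2^-1.
  have tle : t0 <= t by rewrite le_min t0h lerDl ltW.
  have teps : t <= t0 + eps by rewrite ge_min lexx.
  suff t1 : rnorm (one + (h - s t)) <= 1.
    have := ler_rnormD (one + (h - s t)) (s (t - t0)).
    have -> : one + (h - s t) + s (t - t0) = one + (h - s t0).
      by rewrite sD sN; abel.
    by have := ss (t - t0); rewrite ger0_norm; lra.
  have [t2|t2] := leP 2^-1 (t0 + eps).
    have -> : one + (h - s t) = h + s (1 - 2^-1).
      by rewrite /t min_r // sD sN s1; exact: addrCA.
    apply: le_trans (ler_rnormD _ _) _.
    by have := ss (1 - 2^-1); rewrite ger0_norm; lra.
  have tE : t = t0 + eps by rewrite /t min_l // ltW.
  have [|t1|//] := @self_adjoint_sign (h - s t) (sht t).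
    apply: le_trans (ler_rnormD _ _) _; rewrite rnormN.
    have := ss t; have : `|t| <= 2^-1 by rewrite ler_norml tE; lra.
    lra.
  have : t <= t0 by apply: sup_upper_bound => //; split=> //; lra.
  lra.
Qed.

Lemma self_adjoint_scalar h : self_adjoint h -> exists t : R, h = t%:C%C *: one.
Proof.
move=> sh; pose r := (rnorm h *+ 2 + 1)^-1.
have h0 := rnorm_ge0 h.
have r0 : 0 < r by rewrite invr_gt0; lra.
have [|t ht] := self_adjoint_scalar_small (self_adjointZr r sh).
  rewrite rnormZr gtr0_norm // /r mulrC ler_pdivrMr; lra.
exists (r^-1 * t).
rewrite rmorphM -scalerA -ht scaleA -rmorphM /= mulVf ?scale1r //.
by rewrite gt_eqF.
Qed.

End Commutative.

(** * Evaluating the star-Lie polynomial at multiples of the identity *)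

Section StarLiePolynomial.
Variables (R : realType) (A : altCstarAlgebra R) (one : A).
Hypothesis one_id : is_identity one.
Implicit Types (x y s : A).

(** This is [star_comm ('i *: x) y] divided by ['i]. *)
Definition star_jordan x y : A := x ** y + y ** astar x.

Lemma star_comm_imaginary (l : R[i]) x y : Num.conj l = - l ->
  star_comm (l *: x) y = l *: star_jordan x y.
Proof.
by move=> lN; rewrite /star_comm astarZ lN !amulE scaleNr opprK -scalerDr.
Qed.

Lemma star_comm_i1 x : star_comm ('i%C *: one) x = ('i%C * 2) *: x.
Proof.
rewrite star_comm_imaginary ?conjCi // /star_jordan (self_adjoint1 one_id).
by rewrite (amul1l one_id) (amul1r one_id) -mulr2n -[x *+ 2]scaler_nat scaleA.
Qed.

Lemma star_jordan_self_adjoint x y :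
  self_adjoint y -> self_adjoint (star_jordan x y).
Proof. by move=> sy; rewrite /self_adjoint astarD !astarM sy astarK addrC. Qed.

(** On a skew-adjoint element, each bracket with [one] doubles. *)
Lemma foldl_star_comm_1 s m : astar s = - s ->
  foldl (@star_comm R A) s (nseq m one) = 2 ^+ m *: s.
Proof.
elim: m s => [|m IH] s sN /=; first by rewrite expr0 scale1r.
have -> : star_comm s one = s *+ 2.
  by rewrite /star_comm (amul1l one_id) (amul1r one_id) sN opprK mulr2n.
rewrite IH; first by rewrite -[s *+ 2]scaler_nat scaleA exprSr.
by rewrite mulr2n astarD sN opprD.
Qed.

(** The first bracket gives [2 i x], the second [2 i] times [star_jordan x y]; for self-adjoint [y]
    this is skew-adjoint and the remaining entries double it. *)
Lemma foldl_star_comm_i1 x y m : self_adjoint y ->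
  foldl (@star_comm R A) ('i%C *: one) [:: x, y & nseq m one] =
  (2 ^+ m * ('i%C * 2)) *: star_jordan x y.
Proof.
move=> sy /=; have l2N : Num.conj ('i%C * 2 : R[i]) = - ('i%C * 2).
  by rewrite rmorphM /= conjCi rmorph_nat mulNr.
rewrite star_comm_i1 star_comm_imaginary // foldl_star_comm_1 ?scaleA //.
by rewrite astarZ l2N star_jordan_self_adjoint // scaleNr.
Qed.

End StarLiePolynomial.

(** * Identities satisfied by a unital homogeneous star-Lie map *)

Section StarLieMap.
Variables (R : realType) (A A' : altCstarAlgebra R) (one : A) (one' : A').
Hypotheses (one_id : is_identity one) (one_id' : is_identity one').
Variables (n : nat) (phi : A -> A').
Hypothesis n_ge2 : (2 <= n)%N.
Hypothesis phiZ : forall (l : R[i]) (a : A), phi (l *: a) = l *: phi a.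
Hypothesis phi1 : phi one = one'.
Hypothesis phi_Lie : star_Lie_map n phi.
Implicit Types (a b h k x y : A).

Lemma star_Lie_foldl a (s : seq A) : (size s).+1 = n ->
  phi (foldl (@star_comm R A) a s) =
  foldl (@star_comm R A') (phi a) [seq phi b | b <- s].
Proof.
by move=> sn; have /eqP sz : size (a :: s) = n by []; have := phi_Lie (Tuple sz).
Qed.

(** Self-adjointness of [phi y] is assumed because [phi_self_adjoint] is itself derived from the
    case [y = one]. *)
Lemma phi_star_jordan x y : self_adjoint y -> self_adjoint (phi y) ->
  phi (star_jordan x y) = star_jordan (phi x) (phi y).
Proof.
move=> sy sy'.
(* For [n = 2] there is no room for [i one, x, y], so the bracket of [i x] and [y] is used;
   otherwise [n = m + 3]. *)
case: n n_ge2 star_Lie_foldl => [|[|[|m]]] // _ phiL.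
  apply: (scalerI (i_neq0 R)).
  have := phiL ('i%C *: x) [:: y] erefl.
  by rewrite /= !phiZ !star_comm_imaginary ?conjCi // phiZ.
have l0 : 2 ^+ m * ('i%C * 2) != 0 :> R[i].
  by rewrite !mulf_neq0 ?expf_neq0 ?pnatr_eq0 ?i_neq0.
apply: (scalerI l0).
have := phiL ('i%C *: one) [:: x, y & nseq m one].
rewrite (foldl_star_comm_i1 one_id) // [map _ _]/= map_nseq !phiZ phi1.
rewrite (foldl_star_comm_i1 one_id') //; apply.
by rewrite /= size_nseq.
Qed.

Lemma phi0 : phi 0 = 0.
Proof. by rewrite -(scale0r (0 : A)) phiZ scale0r. Qed.

Lemma phiMn x m : phi (x *+ m) = phi x *+ m.
Proof. by rewrite -[x *+ m]scaler_nat phiZ scaler_nat. Qed.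

Lemma phi_add_astar x : phi (x + astar x) = phi x + astar (phi x).
Proof.
have := phi_star_jordan x (self_adjoint1 one_id).
rewrite phi1 /star_jordan !(amul1l one_id, amul1r one_id).
rewrite !(amul1l one_id', amul1r one_id'); apply; exact: self_adjoint1 one_id'.
Qed.

Lemma phi_self_adjoint h : self_adjoint h -> self_adjoint (phi h).
Proof.
move=> sh; have := phi_add_astar h; rewrite sh -mulr2n phiMn mulr2n.
by move/addrI.
Qed.

(** [phi_add_astar] at [x] gives the self-adjoint part of [phi x], and at [i x] the skew-adjoint
    part. *)
Lemma phi_cartesian h k : self_adjoint h -> self_adjoint k ->
  phi (h + 'i%C *: k) = phi h + 'i%C *: phi k.
Proof.
move=> sh sk; set x := h + _.
have re : phi x + astar (phi x) = phi h *+ 2.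
  rewrite -phi_add_astar -phiMn /x astarD astarZi sh sk mulr2n; congr phi; abel.
have im : phi x - astar (phi x) = 'i%C *: phi k *+ 2.
  have := phi_add_astar ('i%C *: x).
  rewrite phiZ [astar ('i%C *: phi x)]astarZi -scalerBr => e.
  have : phi ('i%C *: x + astar ('i%C *: x)) = 'i%C *: ('i%C *: phi k *+ 2).
    rewrite -phiZ -phiMn -phiZ /x; congr phi.
    rewrite astarZi astarD astarZi sh sk !mulr2n !scalerDr scalerN !scaleii; abel.
  by rewrite e; apply/scalerI/i_neq0.
have : phi x *+ 2 = (phi h + 'i%C *: phi k) *+ 2.
  by rewrite mulrnDl -re -im mulr2n; abel.
by move/(congr1 ( *:%R ((2^-1 : R)%:C%C : R[i]))); rewrite !scale_half_double.
Qed.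

(** Both sides are a [star_jordan] with first argument [k + i h], respectively its image. *)
Lemma phi_lie_jordan h k y :
  self_adjoint h -> self_adjoint k -> self_adjoint y ->
  phi ('i%C *: lie h y + jordan k y) =
  'i%C *: lie (phi h) (phi y) + jordan (phi k) (phi y).
Proof.
move=> sh sk sy.
have e (B : altCstarAlgebra R) (h' k' y' : B) : self_adjoint h' ->
    self_adjoint k' ->
    'i%C *: lie h' y' + jordan k' y' = star_jordan (k' + 'i%C *: h') y'.
  move=> sh' sk'; rewrite /star_jordan astarD astarZi sh' sk' /lie /jordan.
  by rewrite !amulE scalerBr; abel.
rewrite !e ?phi_star_jordan ?phi_cartesian //; exact: phi_self_adjoint.
Qed.

Lemma phi_jordan k y : self_adjoint k -> self_adjoint y ->
  phi (jordan k y) = jordan (phi k) (phi y).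
Proof.
move=> sk sy; have := phi_lie_jordan (astar0 A) sk sy.
by rewrite phi0 /lie !amul0l !amul0r !subrr !scaler0 !add0r.
Qed.

Lemma phi_lie h y : self_adjoint h -> self_adjoint y ->
  phi (lie h y) = lie (phi h) (phi y).
Proof.
move=> sh sy; have := phi_lie_jordan sh (astar0 A) sy.
rewrite phi0 /jordan !amul0l !amul0r !addr0 phiZ; apply: scalerI.
exact: (i_neq0 R).
Qed.

Lemma phi_lieD h y b : self_adjoint h -> self_adjoint y -> self_adjoint b ->
  phi ('i%C *: lie h y + b) = phi ('i%C *: lie h y) + phi b.
Proof.
move=> sh sy sb; have [r [k [sk <-]]] := lyapunov one_id sy sb.
set Y := y + _.
have sY : self_adjoint Y.
  by apply/self_adjointD/self_adjointZr/(self_adjoint1 one_id).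
have -> : lie h y = lie h Y.
  by rewrite /lie /Y !amulE (amul1l one_id) (amul1r one_id); abel.
by rewrite phi_lie_jordan // phiZ phi_lie // phi_jordan.
Qed.

(** * The additivity defect and its vanishing *)

Definition defect a b : A' := phi (a + b) - phi a - phi b.

Hypothesis phi_bij : bijective phi.
Hypothesis A'_prime : prime_algebra A'.

Lemma lie_linearr (c x y : A') (l : R[i]) :
  lie c (x + l *: y) = lie c x + l *: lie c y.
Proof. by rewrite /lie !amulE scalerBr; abel. Qed.

Lemma commutingD (c d : A') : commuting c -> commuting d -> commuting (c + d).
Proof.
move=> cC dC x; transitivity (lie c x + lie d x); last by rewrite cC dC addr0.
by rewrite /lie !amulE; abel.
Qed.

Lemma commutingZ (l : R[i]) (c : A') : commuting c -> commuting (l *: c).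
Proof.
move=> cC x; transitivity (l *: lie c x); last by rewrite cC scaler0.
by rewrite /lie !amulE scalerBr.
Qed.

Lemma defect_jordan a b y :
  self_adjoint a -> self_adjoint b -> self_adjoint y ->
  jordan (defect a b) (phi y) = defect (jordan a y) (jordan b y).
Proof.
move=> sa sb sy; rewrite /defect.
have -> : jordan a y + jordan b y = jordan (a + b) y.
  by rewrite /jordan !amulE; abel.
rewrite !phi_jordan //; try exact: self_adjointD.
by rewrite /jordan !amulE; abel.
Qed.

(** Bracketing with [phi y] produces the defect of [lie a y] and [lie b y], which [phi_lieD] kills
    after multiplication by [i]. *)
Lemma defect_commuting a b :
  self_adjoint a -> self_adjoint b -> commuting (defect a b).
Proof.
move=> sa sb.
have sab : self_adjoint (a + b) by exact: self_adjointD.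
have lie_phi y : self_adjoint y -> lie (defect a b) (phi y) = 0.
  move=> sy.
  have -> : lie (defect a b) (phi y) =
      phi (lie (a + b) y) - phi (lie a y) - phi (lie b y).
    by rewrite !phi_lie // /defect /lie !amulE; abel.
  apply: (scalerI (i_neq0 R)); rewrite scaler0 !scalerBr -!phiZ.
  have -> : 'i%C *: lie (a + b) y = 'i%C *: lie a y + 'i%C *: lie b y.
    by rewrite -scalerDr; congr (_ *: _); rewrite /lie !amulE; abel.
  rewrite phi_lieD //; last exact: self_adjoint_lie.
  by rewrite addrAC addrK subrr.
(* By surjectivity and the Cartesian decomposition, every element of [A'] is [phi h + i phi k] with
   [h], [k] self-adjoint. *)
move=> x'; have [psi _ psiK] := phi_bij; rewrite -(psiK x').
have [h [k [sh sk ->]]] := cartesian_decomposition (psi x').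
rewrite phi_cartesian //.
by rewrite lie_linearr !lie_phi // scaler0 addr0.
Qed.

Lemma defect_mul_commuting a b (x' : A') :
  self_adjoint a -> self_adjoint b -> commuting (defect a b ** x').
Proof.
move=> sa sb; have cC := defect_commuting sa sb.
have c_phi y : self_adjoint y -> commuting (defect a b ** phi y).
  (* As the defect is central, its product with [phi y] is half their Jordan product, hence half a
     defect. *)
  move=> sy; rewrite -[_ ** _]scale_half_double; apply: commutingZ.
  rewrite mulr2n [X in _ + X](commutingP _ cC) -/(jordan _ _) defect_jordan //.
  by apply: defect_commuting; exact: self_adjoint_jordan.
have [psi _ psiK] := phi_bij; rewrite -(psiK x').
have [h [k [sh sk ->]]] := cartesian_decomposition (psi x').
rewrite phi_cartesian // amulDr amulZr.
by apply: commutingD; [|apply: commutingZ]; exact: c_phi.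
Qed.

Lemma defect_eq0 a b : self_adjoint a -> self_adjoint b -> defect a b = 0.
Proof.
move=> sa sb; apply/eqP/negP => /negP c0.
have amulC := commuting_ideal_prime A'_prime c0 (defect_commuting sa sb)
  (fun z => defect_mul_commuting z sa sb).
(* [phi h] is a real multiple of [one'], and injectivity of [phi] brings this back to [h]. *)
have scalar h : self_adjoint h -> exists t : R, h = t%:C%C *: one.
  move=> /phi_self_adjoint sh.
  have [t ht] := self_adjoint_scalar one_id' A'_prime amulC sh.
  by exists t; apply: (bij_inj phi_bij); rewrite phiZ phi1.
move/eqP: c0; apply.
have [[s ->] [t ->]] := (scalar a sa, scalar b sb).
by rewrite /defect -scalerDl !phiZ scalerDl; abel.
Qed.

(** * Additivity, multiplicativity and the involution *)

Lemma phiD_self_adjoint a b : self_adjoint a -> self_adjoint b ->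
  phi (a + b) = phi a + phi b.
Proof.
move=> sa sb; have /eqP := defect_eq0 sa sb.
by rewrite /defect -addrA -opprD subr_eq0 => /eqP.
Qed.

Lemma phiD a b : phi (a + b) = phi a + phi b.
Proof.
have [h [k [sh sk ->]]] := cartesian_decomposition a.
have [h' [k' [sh' sk' ->]]] := cartesian_decomposition b.
rewrite addrACA -scalerDr !phi_cartesian ?phiD_self_adjoint //;
  try exact: self_adjointD.
by rewrite scalerDr addrACA.
Qed.

Lemma phiM_self_adjoint h k : self_adjoint h -> self_adjoint k ->
  phi (h ** k) = phi h ** phi k.
Proof.
move=> sh sk.
have e (B : altCstarAlgebra R) (x y : B) : (x ** y) *+ 2 = jordan x y + lie x y.
  by rewrite /jordan /lie mulr2n; abel.
rewrite -[RHS]scale_half_double -[h ** k]scale_half_double phiZ !e.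
by rewrite phiD phi_jordan // phi_lie.
Qed.

Lemma phiM a b : phi (a ** b) = phi a ** phi b.
Proof.
have [h [k [sh sk ->]]] := cartesian_decomposition a.
have [h' [k' [sh' sk' ->]]] := cartesian_decomposition b.
by rewrite !(amulDl, amulDr, amulZl, amulZr, phiD, phiZ) !phiM_self_adjoint.
Qed.

Lemma phi_astar a : phi (astar a) = astar (phi a).
Proof. by have := phi_add_astar a; rewrite phiD => /addrI. Qed.

Lemma star_Lie_isomorphism : star_isomorphism phi.
Proof. by split; [|exact: phiD|exact: phiM| |exact: phi_astar]. Qed.

End StarLieMap.

(** * The converse direction and the equivalence *)

Lemma isomorphism_star_Lie (R : realType) (A A' : altCstarAlgebra R) (n : nat)
    (phi : A -> A') : star_isomorphism phi -> star_Lie_map n phi.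
Proof.
move=> [_ phiD phiM phiZ phi_astar] [s sn]; rewrite /pstar /=.
have phi_comm x y : phi (star_comm x y) = star_comm (phi x) (phi y).
  by rewrite /star_comm -scaleN1r phiD phiZ scaleN1r !phiM phi_astar.
(* On the empty tuple [pstar] has the default value 0, which [phi] fixes by homogeneity. *)
case: s {sn} => [|a s] /=; first by rewrite -(scale0r 0) phiZ scale0r.
by elim: s a => //= b s IH a; rewrite IH phi_comm.
Qed.

Lemma isomorphism_identity (R : realType) (A A' : altCstarAlgebra R) (one : A)
    (one' : A') (phi : A -> A') : is_identity one -> is_identity one' ->
  star_isomorphism phi -> phi one = one'.
Proof.
move=> one_id one_id' [[psi _ psiK] _ phiM _ _].
apply: (identity_unique one_id') => x; rewrite -(psiK x) -!phiM.
by rewrite (amul1l one_id) (amul1r one_id).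
Qed.

Unset Implicit Arguments.

Theorem corollary3p3 (R : realType) (A A' : altCstarAlgebra R)
    (hA : alt_Wstar_factor A) (hA' : alt_Wstar_factor A')
    (one : A) (one' : A')
    (h1 : is_identity one) (h1' : is_identity one')
    (n : nat) (hn : (2 <= n)%N)
    (phi : A -> A')
    (hphi : forall (l : R[i]) (a : A), phi (l *: a) = l *: phi a) :
  [/\ bijective phi, phi one = one' & star_Lie_map n phi]
  <-> star_isomorphism phi.
Proof.
split=> [[phi_bij phi1 phi_Lie]|phi_iso].
  exact: (star_Lie_isomorphism h1 h1' hn hphi phi1 phi_Lie phi_bij hA'.2).
split; first by case: phi_iso.
- exact: isomorphism_identity h1 h1' phi_iso.
- exact: isomorphism_star_Lie.
Qed.
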